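(* Let $p$, $q$ and $r$ be distinct primes and let $G$ be a finite group in $\mathfrak{A}_p\mathfrak{A}_q\mathfrak{A}_r$. Then there exists a subgroup $G_0$ of $G$ with $G_0 \in \mathfrak{A}_p\mathfrak{A}_q\mathfrak{A}_r$ such that the centre $Z(G_0)$ of $G_0$ is trivial and $G = G_0 \times Z(G)$ (internal direct product). Further, the choice of $G_0$ is unique up to isomorphism.
   Context: For a positive integer $n$, $\mathfrak{A}_n$ denotes the variety of abelian groups of exponent dividing $n$. For varieties of groups $\mathfrak{B}, \mathfrak{C}$, the product variety $\mathfrak{B}\mathfrak{C}$ is the class of all groups $G$ that have a normal subgroup $N$ with $N \in \mathfrak{B}$ and $G/N \in \mathfrak{C}$. This product is associative, so $\mathfrak{A}_p\mathfrak{A}_q\mathfrak{A}_r$ is well defined. $Z(G)$ denotes the centre of $G$. *)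

(* Defs.v *)
From mathcomp Require Import all_boot all_fingroup all_solvable.

Set Implicit Arguments.
Unset Strict Implicit.
Unset Printing Implicit Defensive.

Local Open Scope group_scope.

(* Varieties are only represented by their finite members: for a finite group,
   membership in a product variety involves only its subgroups and quotients,
   which are again finite. *)
Definition group_class := forall gT : finGroupType, {group gT} -> Prop.

Definition abelian_variety (n : nat) : group_class :=
  fun gT G => abelian G /\ exponent G %| n.

Definition product_variety (B C : group_class) : group_class :=
  fun gT G => exists N : {group gT},
    [/\ N <| G, B gT N & C (coset_of N) (G / N)%G].

(* The product of varieties is associative; we bracket to the right. *)
Definition variety_ApAqAr (p q r : nat) : group_class :=
  product_variety (abelian_variety p)
    (product_variety (abelian_variety q) (abelian_variety r)).

Definition centreless_factor (p q r : nat) (gT : finGroupType)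
    (G G0 : {group gT}) : Prop :=
  [/\ G0 \subset G, variety_ApAqAr p q r G0,
      'Z(G0) = 1 & G0 \x 'Z(G) = G].

(* Main.v *)
(** Every Sylow subgroup of [G] is elementary abelian, so it splits over any of
    its subgroups, and by Gaschütz's theorem [G] splits over the Sylow
    [s]-subgroup of its centre, for each prime [s]; as that subgroup is central,
    it is a direct factor of [G].  Stripping off these central factors, by
    induction on [#|G|], leaves a centreless [G0] with [G = G0 \x 'Z(G)].  Any
    such [G0] is isomorphic to [G / 'Z(G)]. *)

Require Import Defs.
From mathcomp Require Import all_boot all_fingroup all_solvable.

Set Implicit Arguments.
Unset Strict Implicit.
Unset Printing Implicit Defensive.

Local Open Scope group_scope.

Definition subgroup_closed (B : group_class) :=
  forall (gT : finGroupType) (G H : {group gT}), H \subset G -> B gT G -> B gT H.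

Definition isog_closed (B : group_class) :=
  forall (aT rT : finGroupType) (G : {group aT}) (H : {group rT}),
    G \isog H -> B aT G -> B rT H.

Lemma abelian_variety_subgroup_closed n : subgroup_closed (abelian_variety n).
Proof.
move=> gT G H sHG [abG expG]; split; first exact: abelianS abG.
exact: dvdn_trans (exponentS sHG) expG.
Qed.

Lemma abelian_variety_isog_closed n : isog_closed (abelian_variety n).
Proof.
move=> aT rT G H isoGH [abG expG].
by split; rewrite -?(isog_abelian isoGH) -?(exponent_isog isoGH).
Qed.

(** If [N] witnesses membership of [G], then [N :&: H] does so for [H]. Invariance of [C] under
    isomorphism is required because [H / (N :&: H)] is only isomorphic to the subgroup [H / N] of
    [G / N]. *)
Lemma product_variety_subgroup_closed B C :
    subgroup_closed B -> subgroup_closed C -> isog_closed C ->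
  subgroup_closed (product_variety B C).
Proof.
move=> subB subC isoC gT G H sHG [N [nsNG BN CGN]].
have nNH : H \subset 'N(N) := subset_trans sHG (normal_norm nsNG).
exists (N :&: H)%G; split; first by rewrite /= setIC (normalGI sHG).
  exact: subB (subsetIl N H) BN.
apply: isoC (subC _ (G / N)%G (H / N)%G (quotientS N sHG) CGN).
by rewrite isog_sym; apply: second_isog.
Qed.

Lemma product_variety_isog_closed B C :
  isog_closed B -> isog_closed C -> isog_closed (product_variety B C).
Proof.
move=> isoB isoC aT rT G H /isogP[f injf defH] [N [nsNG BN CGN]].
have sNG := normal_sub nsNG.
exists (f @* N)%G; split; first by rewrite -defH morphim_normal.
  by apply: isoB BN; apply: sub_isog.
apply: isoC CGN; apply/isogP.
exists (quotm_morphism f nsNG); first exact: injm_quotm.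
by rewrite morphim_quotm /= defH.
Qed.

Lemma variety_ApAqAr_subgroup_closed p q r :
  subgroup_closed (variety_ApAqAr p q r).
Proof.
have subA := abelian_variety_subgroup_closed.
have isoA := abelian_variety_isog_closed.
apply: product_variety_subgroup_closed => //.
  exact: product_variety_subgroup_closed.
exact: product_variety_isog_closed.
Qed.

(** Equivalent to all Sylow subgroups being elementary abelian, but phrased so that it passes to
    subgroups at once. *)
Definition primary_subgroups_abelem (gT : finGroupType) (G : {group gT}) :=
  forall (s : nat) (S : {group gT}),
    prime s -> S \subset G -> s.-group S -> s.-abelem S.

Lemma abelian_variety_abelem p (gT : finGroupType) (G : {group gT}) :
  prime p -> abelian_variety p G -> p.-abelem G.
Proof. by move=> p_pr [abG expG]; rewrite abelemE ?abG. Qed.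

Lemma abelem_primary_subgroups_abelem p (gT : finGroupType) (G : {group gT}) :
  p.-abelem G -> primary_subgroups_abelem G.
Proof.
move=> abelG s S s_pr sSG sS; have abelS := abelemS sSG abelG.
have [-> | ntS] := eqsVneq S 1; first exact: abelem1.
have [p_pr p_dv_S _] := pgroup_pdiv (abelem_pgroup abelS) ntS.
by have := pgroupP sS p p_pr p_dv_S; rewrite inE => /eqP <-.
Qed.

(** An [s]-subgroup lies inside [N] when [s = p]; otherwise it meets [N] trivially and so embeds in
    [G / N]. *)
Lemma extension_primary_subgroups_abelem p (gT : finGroupType)
    (G N : {group gT}) :
    N <| G -> p.-abelem N -> p^'.-group (G / N) ->
  primary_subgroups_abelem (G / N)%G -> primary_subgroups_abelem G.
Proof.
move=> nsNG abelN p'GN abelGN s S s_pr sSG sS.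
have nNS : S \subset 'N(N) := subset_trans sSG (normal_norm nsNG).
have [eq_sp | neq_sp] := eqVneq s p.
  (* The image of [S] in [G / N] is a [p]-group inside a [p^']-group, hence trivial. *)
  rewrite {}eq_sp in sS *; apply: abelemS abelN; rewrite -quotient_sub1 //.
  rewrite -(coprime_TIg (pnat_coprime (quotient_pgroup N sS) p'GN)).
  by rewrite subsetI subxx quotientS.
have tiSN : N :&: S = 1.
  rewrite setIC coprime_TIg // (pnat_coprime sS) //.
  apply: sub_in_pnat (abelem_pgroup abelN) => t _.
  by rewrite !inE => /eqP->; rewrite eq_sym.
rewrite (isog_abelem (quotient_isog nNS tiSN)).
by apply: abelGN; rewrite ?quotientS ?quotient_pgroup.
Qed.

(** The layers [N] and [M] are peeled off in turn; distinctness of the primes makes each layer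
    coprime to the quotient above it. *)
Lemma variety_primary_subgroups_abelem p q r (gT : finGroupType)
    (G : {group gT}) :
    prime p -> prime q -> prime r -> p <> q -> p <> r -> q <> r ->
  variety_ApAqAr p q r G -> primary_subgroups_abelem G.
Proof.
move=> p_pr q_pr r_pr /eqP neq_pq /eqP neq_pr /eqP neq_qr.
case=> N [nsNG VN [M [nsMGN VM VQ]]].
have abelN := abelian_variety_abelem p_pr VN.
have abelM := abelian_variety_abelem q_pr VM.
have abelQ := abelian_variety_abelem r_pr VQ.
have p'group s (hT : finGroupType) (H : {group hT}) t :
    s != t -> t.-abelem H -> s^'.-group H.
  move=> neq_st /abelem_pgroup; apply: sub_in_pnat => u _.
  by rewrite !inE => /eqP->; rewrite eq_sym.
apply: (extension_primary_subgroups_abelem nsNG abelN).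
  rewrite -(pquotient_pgroup (p'group _ _ _ _ neq_pq abelM)).
    exact: p'group neq_pr abelQ.
  exact: normal_norm.
apply: (extension_primary_subgroups_abelem nsMGN abelM).
  exact: p'group neq_qr abelQ.
exact: abelem_primary_subgroups_abelem abelQ.
Qed.

Lemma primary_center_dprod s (gT : finGroupType) (G : {group gT}) :
    prime s -> primary_subgroups_abelem G ->
  exists K : {group gT}, K \x 'O_s('Z(G)) = G.
Proof.
move=> s_pr abelG; set A := 'O_s('Z(G))%G.
have sAZ : A \subset 'Z(G) := pcore_sub s _.
have [P sylP] := Sylow_exists s G.
have [sPG sP _] := and3P sylP.
have nsAG : A <| G by apply: sub_center_normal.
have sA : s.-group A := pcore_pgroup s _.
(* A normal [s]-subgroup lies in every Sylow [s]-subgroup. *)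
have sAP : A \subset P.
  by apply: subset_trans (pcore_max sA nsAG) (pcore_sub_Hall sylP).
have abA : abelian A := abelianS sAZ (center_abelian G).
have coAiP : coprime #|A| #|G : P|.
  by apply: pnat_coprime sA _; case/and3P: sylP.
have: [splits G, over A].
  rewrite (Gaschutz_split nsAG sAP sPG abA coAiP).
  exact: abelem_splits (abelG s P s_pr sPG sP) sAP.
case/splitsP=> K /complP[tiAK defG]; exists K.
(* Centrality of [A] turns the complement [K] into a direct factor. *)
have cKA : A \subset 'C(K).
  have sKG : K \subset G by rewrite -defG mulG_subr.
  by apply: subset_trans sAZ (subset_trans (subsetIr _ _) (centS sKG)).
by rewrite dprodE // 1?setIC // -(centC cKA).
Qed.

Lemma center_dprod_centreless (gT : finGroupType) (G : {group gT}) :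
    primary_subgroups_abelem G ->
  exists G0 : {group gT}, 'Z(G0) = 1 /\ G0 \x 'Z(G) = G.
Proof.
have [m] := ubnP #|G|; elim: m G => // m IHm G /ltnSE-leGm abelG.
have [Z1 | ntZ] := eqsVneq 'Z(G) 1; first by exists G; rewrite Z1 dprodg1.
set s := pdiv #|'Z(G)|.
have s_pr : prime s by rewrite pdiv_prime ?cardG_gt1.
have [K defG] := primary_center_dprod s_pr abelG.
(* This core is the Sylow [s]-subgroup of the abelian group ['Z(G)], and [s] divides the order of
   ['Z(G)]; hence [K] is strictly smaller than [G]. *)
have ntA : 'O_s('Z(G)) != 1.
  have sylA := nilpotent_pcore_Hall s (abelian_nil (center_abelian G)).
  by rewrite -rank_gt0 (rank_Sylow sylA) p_rank_gt0 pi_pdiv cardG_gt1.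
have ltKm : #|K| < m.
  apply: leq_trans leGm; rewrite -(dprod_card defG) ltn_Pmulr ?cardG_gt0 //.
  by rewrite cardG_gt1.
have sKG : K \subset G by case/dprodP: defG => _ <- _ _; rewrite mulG_subl.
have abelK : primary_subgroups_abelem K.
  by move=> t S t_pr sSK; apply: abelG t_pr (subset_trans sSK sKG).
have [G0 [Z1 defK]] := IHm K ltKm abelK.
exists G0; split=> //.
(* With [A] for the core, ['Z(G)] is ['Z(K) \x A], so [G0 \x 'Z(G)] regroups as
   [(G0 \x 'Z(K)) \x A], which is [K \x A]. *)
have cA : 'Z('O_s('Z(G))) = 'O_s('Z(G)).
  by apply/center_idP; apply: abelianS (pcore_sub _ _) (center_abelian G).
by rewrite -(center_dprod defG) cA dprodA defK.
Qed.

Theorem theorem4p2 (p q r : nat) (gT : finGroupType) (G : {group gT})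
    (p_pr : prime p) (q_pr : prime q) (r_pr : prime r)
    (neq_pq : p <> q) (neq_pr : p <> r) (neq_qr : q <> r)
    (GV : variety_ApAqAr p q r G) :
  (exists G0 : {group gT}, centreless_factor p q r G G0) /\
  (forall G0 G1 : {group gT},
     centreless_factor p q r G G0 -> centreless_factor p q r G G1 ->
     G0 \isog G1).
Proof.
split=> [|G0 G1 [_ _ _ defG0] [_ _ _ defG1]].
  have abelG : primary_subgroups_abelem G.
    exact: variety_primary_subgroups_abelem neq_pq neq_pr neq_qr GV.
  have [G0 [Z1 defG]] := center_dprod_centreless abelG.
  have sG0G : G0 \subset G by case/dprodP: defG => _ <- _ _; rewrite mulG_subl.
  by exists G0; split=> //; apply: variety_ApAqAr_subgroup_closed GV.
have isoGZ (H : {group gT}) : H \x 'Z(G) = G -> H \isog G / 'Z(G).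
  by rewrite dprodC => /dprodWsd; apply: sdprod_isog.
by apply: isog_trans (isoGZ _ defG0) _; rewrite isog_sym isoGZ.
Qed.
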